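(* Let $X\in\mathbb R^{d\times n}$, let $1\le K\le d$, and let $\{U^k\}\subset \mathrm{St}(d,K)$ be generated by the non-greedy algorithm (NGA) $$U^{k+1}=\operatorname{PD}\big(X\operatorname{sgn}(X^\top U^k)\big),$$ interpreted as the conditional subgradient iteration $U^{k+1}=\operatorname{PD}(XS^k)$ with $S^k=\operatorname{sgn}(X^\top U^k)$. If $\operatorname{rank}(XS^k)=K$ for all $k$, then after finitely many steps the algorithm finds a point $U^*$ which is a FOC point of the $L_1$-norm PCA problem $\max_{U\in\mathrm{St}(d,K)}\|X^\top U\|_1$.
   Context: $\mathrm{St}(m,n)=\{U\in\mathbb R^{m\times n}: U^\top U=I\}$, $m\ge n$. $\|\cdot\|_1$ is the entrywise $L_1$-norm of a matrix and $\langle\cdot,\cdot\rangle$ is the standard inner product of matrices. $\operatorname{sgn}(x)=x/|x|$ if $x\ne0$, $\operatorname{sgn}(0)=0$, applied entrywise to matrices. Polar decomposition: for $C\in\mathbb R^{m\times n}$, $m\ge n$, a polar decomposition is $C=UH$ with $U\in\mathrm{St}(m,n)$ and $H\in\mathbb R^{n\times n}$ symmetric positive semidefinite; $U$ is called a $U$-factor of $C$ (unique if $\operatorname{rank}(C)=n$). $U=\operatorname{PD}(C)$ means that $U$ is a $U$-factor of $C$. $\partial\|V\|_1\big|_{V=X^\top U}$ is the subdifferential of $\|\cdot\|_1$ at $X^\top U$, i.e. the set of $S\in\mathbb R^{n\times K}$ with $S_{ij}=\operatorname{sgn}((X^\top U)_{ij})$ if $(X^\top U)_{ij}\neq0$ and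 $S_{ij}\in[-1,1]$ otherwise. In particular, $XS^k$ is a subgradient of $U\mapsto\|X^\top U\|_1$ at $U^k$. A matrix $U\in\mathrm{St}(d,K)$ is a FOC (first-order optimality criteria) point if there is $W\in X\,\partial\|V\|_1\big|_{V=X^\top U}$ with $\langle W,U-Z\rangle\ge 0$ for all $Z\in\mathrm{St}(d,K)$. *)

(* Defs.v *)
From mathcomp Require Import all_boot all_order all_algebra.
From mathcomp Require Import lra.
From mathcomp Require Import classical_sets reals.

Set Implicit Arguments.
Unset Strict Implicit.
Unset Printing Implicit Defensive.

Import Order.TTheory GRing.Theory Num.Theory.
Local Open Scope ring_scope.
Local Open Scope classical_set_scope.

Section Defs.
Variable R : realType.

(* Empty unless n <= m. *)
Definition stiefel m n : set 'M[R]_(m, n) := [set U | U^T *m U = 1%:M].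

Definition mxinner m n (A B : 'M[R]_(m, n)) : R := \tr (A^T *m B).

Definition l1norm m n (A : 'M[R]_(m, n)) : R := \sum_i \sum_j `|A i j|.

(* Num.sg 0 = 0, in accordance with the convention sgn 0 = 0. *)
Definition sgnmx m n (A : 'M[R]_(m, n)) : 'M[R]_(m, n) := map_mx Num.sg A.

Definition sym_psd n (H : 'M[R]_n) : Prop :=
  H^T = H /\ forall x : 'cV[R]_n, 0 <= (x^T *m H *m x) 0 0.

(* U = PD(C) is a relation, since a rank-deficient C has several U-factors. *)
Definition is_PD m n (C U : 'M[R]_(m, n)) : Prop :=
  stiefel U /\ exists H : 'M[R]_n, sym_psd H /\ C = U *m H.

Definition subdifferential m n (f : 'M[R]_(m, n) -> R) (V : 'M[R]_(m, n)) :
    set 'M[R]_(m, n) :=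
  [set S | forall V', f V + mxinner S (V' - V) <= f V'].

(* A FOC point of  max { ||X^T U||_1 : U in St(d, K) }. *)
Definition is_FOC d n K (X : 'M[R]_(d, n)) (U : 'M[R]_(d, K)) : Prop :=
  stiefel U /\
  exists2 W, [set X *m S | S in subdifferential (@l1norm n K) (X^T *m U)] W
           & forall Z, stiefel Z -> 0 <= mxinner W (U - Z).

Lemma mxinnerE m n (A B : 'M[R]_(m, n)) :
  mxinner A B = \sum_i \sum_j A i j * B i j.
Proof.
rewrite /mxinner /mxtrace exchange_big /=; apply: eq_bigr => j _.
by rewrite mxE; apply: eq_bigr => i _; rewrite mxE.
Qed.

(* The coordinatewise description of the subdifferential of the L1-norm. *)
Lemma subdifferential_l1normP m n (V S : 'M[R]_(m, n)) :
  subdifferential (@l1norm m n) V S <->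
  forall i j, if V i j != 0 then S i j = Num.sg (V i j)
              else -1 <= S i j <= 1.
Proof.
split=> [H i j | H V'].
- have key t : `|V i j| + S i j * t <= `|V i j + t|.
    pose V' := V + t *: delta_mx i j.
    pose D k l := `|V' k l| - (`|V k l| + S k l * (V' - V) k l).
    have D0 k l : (k, l) != (i, j) -> D k l = 0.
      rewrite -pair_eqE /= => /negPf ne.
      by rewrite /D !mxE ne !mulr0 !addr0 subrr mulr0 addr0 subrr.
    have: 0 <= \sum_k \sum_l D k l.
      under eq_bigr do rewrite sumrB big_split.
      rewrite sumrB big_split /= -mxinnerE subr_ge0; exact: H.
    rewrite pair_big /= (bigD1 (i, j)) //= big1 => [|[k l]]; last exact: D0.
    by rewrite addr0 subr_ge0 !mxE !eqxx mulr1 [V i j + t - _]addrC addKr.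
  case: ifPn => [V0 | /negPn/eqP V0].
    have := key (V i j); have := key (- V i j).
    rewrite subrr normr0; case: (ltrgt0P (V i j)) V0 => // v _ h1 h2.
      rewrite gtr0_sg //.
      by apply: (mulIf (lt0r_neq0 v)); move: h1 h2; rewrite gtr0_norm; lra.
    rewrite ltr0_sg //.
    by apply: (mulIf (ltr0_neq0 v)); move: h1 h2; rewrite ltr0_norm; lra.
  have := key 1; have := key (-1).
  by rewrite V0 !add0r normrN normr1 normr0; lra.
- rewrite mxinnerE /l1norm -big_split /=; apply: ler_sum => i _.
  rewrite -big_split /=; apply: ler_sum => j _; rewrite !mxE.
  move: (H i j); case: ifPn => [V0 -> | /negPn/eqP -> /andP[h1 h2]].
    rewrite mulrBr -normrEsg addrC subrK.
    apply: le_trans (ler_norm _) _.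
    by rewrite normrM normr_sg V0 mul1r.
  rewrite normr0 add0r subr0; apply: le_trans (ler_norm _) _.
  by rewrite normrM ler_piMl // ler_norml h1 h2.
Qed.

End Defs.

(* Main.v *)
(** For [C = U H] with [U] in the Stiefel manifold and [H] symmetric positive
    semidefinite, every [Z] in the manifold satisfies
    [2 <C, U - Z> = tr ((U - Z) H (U - Z)^T) >= 0], and for [C] of full rank
    [H] is nonsingular, so equality forces [Z = U].  Taking
    [C = X sgn (X^T U^k)], the objective is nondecreasing along the iteration
    and stationary only at fixed points.  The iterate [U^{k+1}] is a function
    of the sign pattern [sgn (X^T U^k)], of which there are finitely many;
    hence some iterate recurs, the objective is constant in between, and the
    iteration has reached a fixed point, which is a FOC point. *)
Require Import Defs.
From mathcomp Require Import all_boot all_order all_algebra.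
From mathcomp Require Import classical_sets reals.
From mathcomp Require Import ring lra.
Import Order.TTheory GRing.Theory Num.Theory.
Local Open Scope ring_scope.

Section ConditionalSubgradient.
Set Implicit Arguments.
Unset Strict Implicit.
Variable R : realType.

(** With [y = H x], the form at [x + t y] is [2 t |y|^2 + t^2 b]; being nonnegative for all [t], it
    must have zero linear coefficient. *)
Lemma sym_psd_ker n (H : 'M[R]_n) (x : 'cV[R]_n) :
  sym_psd H -> (x^T *m H *m x) 0 0 = 0 -> H *m x = 0.
Proof.
move=> [Hsym Hpos] x0; set y := H *m x.
pose a := (y^T *m y) 0 0; pose b := (y^T *m H *m y) 0 0.
have b0 : 0 <= b by exact: Hpos.
have xy : x^T *m H = y^T by rewrite /y trmx_mul Hsym.
have key t : 0 <= t * a *+ 2 + t ^+ 2 * b.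
  have := Hpos (x + t *: y).
  have -> : (x + t *: y)^T *m H *m (x + t *: y) =
      x^T *m H *m x + (t *: (y^T *m y) *+ 2) + t ^+ 2 *: (y^T *m H *m y).
    have -> : (x + t *: y)^T = x^T + t *: y^T by rewrite linearD linearZ.
    rewrite !mulmxDl !mulmxDr -!scalemxAl -!scalemxAr scalerA.
    by rewrite -(mulmxA y^T H x) -/y xy expr2 mulr2n !addrA.
  by rewrite mxE [X in X + _]mxE x0 add0r mulmxnE /a /b !mxE.
have a_sum : a = \sum_i y i 0 ^+ 2.
  by rewrite /a mxE; apply: eq_bigr => i _; rewrite mxE expr2.
have a0 : a = 0.
  have a_ge0 : 0 <= a by rewrite a_sum sumr_ge0 // => i _; exact: sqr_ge0.
  have b1 : 0 < 1 + b by lra.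
  have := key (- (a / (1 + b))).
  have -> : - (a / (1 + b)) * a *+ 2 + (- (a / (1 + b))) ^+ 2 * b =
    - (a ^+ 2 * ((2 + b) / (1 + b) ^+ 2)) by field; rewrite gt_eqF.
  rewrite oppr_ge0 pmulr_lle0; last by rewrite divr_gt0 ?exprn_gt0 //; lra.
  by move=> a2; apply/eqP; rewrite -sqrf_eq0 eq_le a2 sqr_ge0.
apply/matrixP => i j; rewrite ord1 [RHS]mxE; apply/eqP.
have /psumr_eq0P/(_ i isT)/eqP : \sum_i y i 0 ^+ 2 = 0 by rewrite -a_sum.
by rewrite sqrf_eq0; apply=> k _; exact: sqr_ge0.
Qed.

Lemma mxtrace_congr m n (H : 'M[R]_n) (A : 'M[R]_(m, n)) :
  \tr (A *m H *m A^T) = \sum_i ((row i A)^T^T *m H *m (row i A)^T) 0 0.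
Proof.
apply: eq_bigr => i _; rewrite trmxK -row_mul !mxE.
by apply: eq_bigr => j _; rewrite !mxE.
Qed.

Lemma mxtrace_psd_ge0 m n (H : 'M[R]_n) (A : 'M[R]_(m, n)) :
  sym_psd H -> 0 <= \tr (A *m H *m A^T).
Proof. by move=> [_ Hpos]; rewrite mxtrace_congr sumr_ge0. Qed.

Lemma mxtrace_psd_eq0 m n (H : 'M[R]_n) (A : 'M[R]_(m, n)) :
  sym_psd H -> \tr (A *m H *m A^T) = 0 -> A *m H = 0.
Proof.
move=> Hpsd; rewrite mxtrace_congr => /psumr_eq0P A0.
apply/row_matrixP => i; rewrite row_mul row0; apply: trmx_inj.
rewrite trmx_mul trmx0 (proj1 Hpsd); apply: sym_psd_ker => //.
by apply: A0 => // k _; apply: (proj2 Hpsd).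
Qed.

Lemma polar_gap m n (H : 'M[R]_n) (U Z : 'M[R]_(m, n)) :
  H^T = H -> stiefel U -> stiefel Z ->
  mxinner (U *m H) (U - Z) *+ 2 = \tr ((U - Z) *m H *m (U - Z)^T).
Proof.
rewrite /stiefel /= => Hsym UU ZZ.
have -> : mxinner (U *m H) (U - Z) = \tr H - \tr (H *m (U^T *m Z)).
  rewrite /mxinner trmx_mul Hsym mulmxBr linearB /= -!mulmxA UU.
  by rewrite mulmx1.
rewrite -[in RHS]mulmxA [RHS]mxtrace_mulC -[in RHS]mulmxA.
have -> : (U - Z)^T *m (U - Z) = 1%:M - U^T *m Z - (Z^T *m U - 1%:M).
  have -> : (U - Z)^T = U^T - Z^T by rewrite linearB.
  by rewrite mulmxBl !mulmxBr UU ZZ opprB.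
rewrite !mulmxBr !linearB /= mulmx1.
have -> : \tr (H *m (Z^T *m U)) = \tr (H *m (U^T *m Z)).
  by rewrite -mxtrace_tr !trmx_mul trmxK Hsym mxtrace_mulC.
by ring.
Qed.

Lemma is_PD_max m n (C U Z : 'M[R]_(m, n)) :
  is_PD C U -> stiefel Z -> 0 <= mxinner C (U - Z).
Proof.
move=> [US [H [Hpsd ->]]] ZS; rewrite -(pmulrn_lge0 _ (n := 2)) //.
by rewrite polar_gap ?(proj1 Hpsd) // mxtrace_psd_ge0.
Qed.

Lemma is_PD_max_eq m n (C U Z : 'M[R]_(m, n)) :
  is_PD C U -> \rank C = n -> stiefel Z -> mxinner C (U - Z) <= 0 -> Z = U.
Proof.
move=> PDU rC ZS le0.
have /eqP eq0 : mxinner C (U - Z) == 0 by rewrite eq_le le0 is_PD_max.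
case: PDU => US [H [Hpsd CE]].
(* [H] inherits full rank from [C], since [C = U H] has rank at most that of [H]. *)
have Hfree : row_free H.
  by rewrite /row_free eqn_leq rank_leq_row -[leqLHS]rC CE mxrankM_maxr.
have /mxtrace_psd_eq0 : \tr ((U - Z) *m H *m (U - Z)^T) = 0.
  by rewrite -polar_gap ?(proj1 Hpsd) // -CE eq0 mul0rn.
move=> /(_ Hpsd) AH0; apply/eqP; rewrite eq_sym -subr_eq0; apply/eqP.
by apply: (row_free_inj Hfree); rewrite AH0 mul0mx.
Qed.

(** Both factors maximise the inner product with [C], so the equality case applies. *)
Lemma is_PD_uniq m n (C U U' : 'M[R]_(m, n)) :
  is_PD C U -> is_PD C U' -> \rank C = n -> U = U'.
Proof.
move=> PDU PDU' rC; apply/esym/(is_PD_max_eq PDU rC); first by case: PDU'.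
have := is_PD_max PDU' (proj1 PDU).
by rewrite -opprB /mxinner mulmxN linearN oppr_ge0.
Qed.

Lemma sgnmx_subdifferential m n (V : 'M[R]_(m, n)) :
  subdifferential (@l1norm R m n) V (sgnmx V).
Proof.
apply/subdifferential_l1normP => i j; rewrite mxE.
by case: ifPn => // /negPn/eqP ->; rewrite sgr0; lra.
Qed.

(** The subgradient inequality at [X^T U], with [X] moved across the inner product. *)
Lemma l1norm_step d n K (X : 'M[R]_(d, n)) (U U' : 'M[R]_(d, K)) :
  l1norm (X^T *m U) + mxinner (X *m sgnmx (X^T *m U)) (U' - U)
    <= l1norm (X^T *m U').
Proof.
have := sgnmx_subdifferential (X^T *m U) (X^T *m U').
by rewrite -mulmxBr /mxinner mulmxA -trmx_mul.
Qed.

Lemma sgnmx_recurs m n (V : nat -> 'M[R]_(m, n)) :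
  exists i j : nat, (i < j)%N /\ sgnmx (V i) = sgnmx (V j).
Proof.
(* The tests [x == 0] and [x < 0] determine [Num.sg x], so sign patterns embed in a finite type and
   the pigeonhole principle applies. *)
pose T : finType := 'M[bool * bool]_(m, n).
pose g (k : 'I_#|T|.+1) : T := \matrix_(i, j) (V k i j == 0, V k i j < 0).
have gS k l : g k = g l -> sgnmx (V k) = sgnmx (V l).
  move=> /matrixP gkl; apply/matrixP => i j; have := gkl i j.
  by rewrite !mxE => -[e1 e2]; rewrite /Num.sg e1 e2.
have /injectivePn[k [l kl /gS gkl]] : ~~ injectiveb g.
  by apply/injectiveP => /leq_card; rewrite card_ord ltnn.
case: (ltngtP k l) => [lt|lt|/val_inj e]; last by rewrite e eqxx in kl.
  by exists k, l.
by exists l, k.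
Qed.

End ConditionalSubgradient.

Theorem theorem3p1 (R : realType) (d n K : nat) (X : 'M[R]_(d, n))
    (U : nat -> 'M[R]_(d, K)) (K_gt0 : (0 < K)%N) (leKd : (K <= d)%N)
    (U_St : forall k : nat, stiefel (U k))
    (U_NGA : forall k : nat, is_PD (X *m sgnmx (X^T *m U k)) (U k.+1))
    (rankXS : forall k : nat, \rank (X *m sgnmx (X^T *m U k)) = K) :
  exists (Ustar : 'M[R]_(d, K)) (k0 : nat),
    is_FOC X Ustar /\ (forall k : nat, (k0 <= k)%N -> U k = Ustar).
Proof.
have det k l : sgnmx (X^T *m U k) = sgnmx (X^T *m U l) -> U k.+1 = U l.+1.
  move=> e; apply: is_PD_uniq (U_NGA k) _ (rankXS k).
  by rewrite e; exact: U_NGA.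
pose f k := l1norm (X^T *m U k).
have f_mono : {homo f : k l / (k <= l)%N >-> k <= l}.
  apply: homo_leq => [//|? ? ?|k]; first exact: le_trans.
  apply: le_trans (l1norm_step X (U k) (U k.+1)).
  by rewrite lerDl; exact: is_PD_max.
have [i [j [ij /det eU]]] := sgnmx_recurs (fun k => X^T *m U k).
have fix_i : U i.+1 = U i.+2.
  apply: is_PD_max_eq (U_NGA i.+1) (rankXS _) (U_St _) _.
  (* Since [i < j], [i.+2 <= j.+1], and the objective at [j.+1] equals that at [i.+1]. *)
  have f_le : f i.+2 <= f i.+1 by rewrite {2}/f eU; exact: f_mono.
  by have := le_trans (l1norm_step X (U i.+1) (U i.+2)) f_le; rewrite gerDl.
exists (U i.+1), i.+1; split.
  split=> //; exists (X *m sgnmx (X^T *m U i.+1)).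
    by exists (sgnmx (X^T *m U i.+1)) => //; exact: sgnmx_subdifferential.
  (* As a fixed point, [U i.+1] is a polar factor of its own [X S]. *)
  by move=> Z ZS; rewrite {2}fix_i; exact: is_PD_max.
(* Once reached, the fixed point persists: equal iterates have equal sign patterns, hence equal
   successors. *)
elim=> // k IH; rewrite leq_eqVlt => /predU1P[<- //|/IH Uk].
by rewrite fix_i; apply: det; rewrite Uk.
Qed.
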